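(* Let $I_n$ denote the number of inversion sequences of length $n$ avoiding all of the patterns $100$, $102$, $201$, $210$ (with $I_0=1$). Then $$\sum_{n\ge0} I_n z^n=\frac{(1-4z)(1-2z)(3-2z)-(1-8z+12z^2-2z^3)\sqrt{1-4z}}{2(1-z)^2(1-4z)} = 1+z+2z^2+6z^3+21z^4+76z^5+\cdots.$$
   Context: An inversion sequence of length $n$ is an integer sequence $(a_1,\dots,a_n)$ with $0\le a_i<i$ for all $i$. A pattern is a sequence $\sigma$ of non-negative integers containing every value from $0$ to $\max(\sigma)$; the reduction of a sequence replaces its smallest values by $0$, the next smallest by $1$, etc. A sequence $a$ contains $\sigma$ if some (not necessarily consecutive) subsequence of $a$ has reduction $\sigma$; otherwise $a$ avoids $\sigma$. Equivalently, these are the inversion sequences with no $i<j<k$ such that $a_i>a_j$ and $a_i\ne a_k$. The square root is the power series with constant term $1$. *)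

(* Defs.v *)
From HB Require Import structures.
From mathcomp Require Import all_boot all_order all_algebra.
Set Implicit Arguments. Unset Strict Implicit. Unset Printing Implicit Defensive.
Import Order.TTheory GRing.Theory Num.Theory.

Definition red (s : seq nat) : seq nat :=
  [seq size (undup [seq y <- s | y < x]) | x <- s].

Definition contains (s : seq nat) (p : seq nat) : bool :=
  [exists m : (size s).-tuple bool, red (mask m s) == p].

Definition avoids (s : seq nat) (p : seq nat) : bool := ~~ contains s p.

Definition seq_of n (f : {ffun 'I_n -> 'I_n}) : seq nat :=
  [seq val (f i) | i <- enum 'I_n].

(* inversion sequence: a_i < i in 1-indexed terms, i.e. f i <= i 0-indexed *)
Definition is_inv_seq n (f : {ffun 'I_n -> 'I_n}) : bool :=
  [forall i : 'I_n, val (f i) <= val i].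

Definition I_count (n : nat) : nat :=
  #|[set f : {ffun 'I_n -> 'I_n} | is_inv_seq f &&
       all (avoids (seq_of f)) [:: [:: 1; 0; 0]; [:: 1; 0; 2]; [:: 2; 0; 1]; [:: 2; 1; 0]]]|.

Definition fps := nat -> rat.
Local Open Scope ring_scope.
Definition fps_mul (f g : fps) : fps :=
  fun n => \sum_(k < n.+1) f k * g (n - k)%N.
Definition fps_sub (f g : fps) : fps := fun n => f n - g n.
Definition fps_poly (l : seq rat) : fps := fun n => nth 0 l n.
Definition fps_one : fps := fps_poly [:: 1].

(* Main.v *)
Require Import Defs.
From HB Require Import structures.
From mathcomp Require Import all_boot all_order all_algebra.
From mathcomp Require Import zify ring lra.
Import GRing.Theory Num.Theory.
Local Open Scope ring_scope.

(* Up to its first descent a sequence in the class is weakly increasing.  If the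
   descent is to the value v, then all earlier entries above v must coincide,
   and every later entry must equal that common value.  Hence
     I_(n+1) = (n+1) C_n + E_n,   E_(n+1) = E_n + G_n,   G_(n+1) = G_n + T_n,
   where C_n is the number of weakly increasing inversion sequences and
   T_n = C_(n+2) - 2 C_(n+1).  Reading off C_n = (2n)! / (n! (n+1)!) from the
   ballot numbers, and S_(n+1) = -2 C_n from (1 - 4z) S' = -2 S, turns the claim,
   multiplied by its denominator, into an identity between hypergeometric terms. *)

(** * Reversed inversion sequences and forbidden triples *)

Section Counting.
Local Open Scope nat_scope.

(* Inversion sequences are stored reversed, so that consing appends an entry at
   the right end. *)
Fixpoint rinvs (n : nat) : seq (seq nat) :=
  if n is m.+1 then [seq x :: r | r <- rinvs m, x <- index_iota 0 m.+1]
  else [:: [::]].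

Fixpoint rinv (r : seq nat) : bool :=
  if r is x :: r' then (x <= size r') && rinv r' else true.

(* [forces x r]: no a_i > a_j with i < j and a_i <> x, so that x may be appended
   without completing a forbidden triple. *)
Fixpoint forces (x : nat) (r : seq nat) : bool :=
  if r is y :: r' then forces x r' && all (fun a => (y < a) ==> (a == x)) r'
  else true.

Fixpoint good (r : seq nat) : bool :=
  if r is x :: r' then good r' && forces x r' else true.

Definition inc (r : seq nat) : bool := sorted geq r.
#[global] Arguments inc r : simpl never.

Lemma rinvsS n :
  rinvs n.+1 = [seq x :: r | r <- rinvs n, x <- index_iota 0 n.+1].
Proof. by []. Qed.

Lemma mem_rinvs n r : (r \in rinvs n) = (size r == n) && rinv r.
Proof.
elim: n r => [|n IH] r; first by case: r.
rewrite rinvsS; apply/allpairsP/idP => [[[u v] /= [Hu Hv ->]]|].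
  move: Hu Hv; rewrite IH mem_index_iota /= eqSS => /andP[/eqP Hs ->].
  by rewrite Hs eqxx andbT ltnS.
case: r => //= x r; rewrite eqSS => /andP[Hs /andP[Hx Hr]]; exists (r, x); split=> //=.
  by rewrite IH Hs.
by rewrite mem_index_iota ltnS -(eqP Hs).
Qed.

Lemma rinvs_uniq n : uniq (rinvs n).
Proof.
elim: n => // n IH; rewrite rinvsS; apply: allpairs_uniq; rewrite ?iota_uniq //.
by move=> [a b] [c d] _ _ /= [-> ->].
Qed.

Lemma head_rinvs n r : r \in rinvs n -> head 0 r <= n.
Proof.
by rewrite mem_rinvs; case: r => [|x r] //= /andP[/eqP <- /andP[Hx _]]; apply: leqW.
Qed.

(** [subseq] matches greedily. When c = x, skipping x gains nothing, since an embedding of [c :: l]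
    in [r] contains one of [l]. *)
Lemma subseq_cons2 (c x : nat) l r :
  subseq (c :: l) (x :: r) = (c == x) && subseq l r || subseq (c :: l) r.
Proof.
rewrite /=; case: eqP => [->|] //=.
case: (boolP (subseq l r)) => //= H; apply/esym/negbTE/(contra _ H) => H2.
exact: subseq_trans (subseq_cons _ _) H2.
Qed.

Lemma forcesPn x r :
  reflect (exists b a, [/\ subseq [:: b; a] r, b < a & a != x]) (~~ forces x r).
Proof.
elim: r => [|y r IH]; first by constructor=> -[b [a []]].
rewrite [forces _ _]/= negb_and; apply: (iffP orP).
  case=> [/IH[b [a [H1 H2 H3]]]|/allPn[a Ha]].
    by exists b, a; rewrite subseq_cons2 H1 orbT.
  rewrite negb_imply => /andP[H1 H2]; exists y, a; split=> //.
  by rewrite subseq_cons2 eqxx sub1seq Ha.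
case=> b [a []]; rewrite subseq_cons2 sub1seq => /orP[/andP[/eqP-> Ha] H1 H2|H1 H2 H3].
  by right; apply/allPn; exists a => //; rewrite negb_imply H1.
by left; apply/IH; exists b, a.
Qed.

Lemma goodPn r :
  reflect (exists c b a, [/\ subseq [:: c; b; a] r, b < a & a != c]) (~~ good r).
Proof.
elim: r => [|y r IH]; first by constructor=> -[c [b [a []]]].
rewrite [good _]/= negb_and; apply: (iffP orP).
  case=> [/IH[c [b [a [H1 H2 H3]]]]|/forcesPn[b [a [H1 H2 H3]]]].
    by exists c, b, a; rewrite subseq_cons2 H1 orbT.
  by exists y, b, a; rewrite subseq_cons2 eqxx H1.
case=> c [b [a []]]; rewrite subseq_cons2 => /orP[/andP[/eqP-> H1] H2 H3|H1 H2 H3].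
  by right; apply/forcesPn; exists b, a.
by left; apply/IH; exists c, b, a.
Qed.

Lemma containsP s p :
  reflect (exists2 t, subseq t s & red t = p) (contains s p).
Proof.
apply: (iffP existsP) => [[m /eqP H]|[t /subseqP[m Hm ->] H]].
  by exists (mask m s) => //; apply: mask_subseq.
by exists (Tuple (introT eqP Hm)); apply/eqP.
Qed.

(** Given b < a, the place of c decides: c < b gives 210, c = b gives 100, b < c < a gives 201, a <
    c gives 102. Only c = a, the pattern 101, is allowed. *)
Lemma red3_bad a b c :
  (red [:: a; b; c] \in [:: [:: 1; 0; 0]; [:: 1; 0; 2]; [:: 2; 0; 1]; [:: 2; 1; 0]])
  = (b < a) && (a != c).
Proof.
rewrite /red /= !ltnn.
case: (ltngtP a b) => Hab; case: (ltngtP a c) => Hac; case: (ltngtP b c) => Hbc;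
  try (exfalso; lia); subst;
  rewrite /= ?inE ?eqxx ?ltnn ?(ltn_eqF Hab) ?(gtn_eqF Hab) ?(ltn_eqF Hac)
    ?(gtn_eqF Hac) ?(ltn_eqF Hbc) ?(gtn_eqF Hbc) //=.
Qed.

Lemma avoids_good s :
  all (avoids s) [:: [:: 1; 0; 0]; [:: 1; 0; 2]; [:: 2; 0; 1]; [:: 2; 1; 0]] =
  good (rev s).
Proof.
apply: negb_inj; rewrite -has_predC.
apply/hasP/goodPn => [[p Hp] /=|[c [b [a [H1 H2 H3]]]]].
  rewrite /avoids negbK => /containsP[t Ht Er].
  (* [red] preserves length and all four patterns have length 3. *)
  have: size t = 3 by move: Hp; rewrite -(size_map (fun x => size (undup [seq y <- t | y < x])) t) -/(red t) Er !inE => /or4P[] /eqP->.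
  case: t Ht Er => [|a [|b [|c [|]]]] // Ht Er _.
  move: Hp; rewrite -Er red3_bad => /andP[H1 H2]; exists c, b, a; split=> //.
  by rewrite -[[:: c; b; a]]/(rev [:: a; b; c]) subseq_rev.
exists (red [:: a; b; c]); first by rewrite red3_bad H2.
rewrite /= /avoids negbK; apply/containsP; exists [:: a; b; c] => //.
by rewrite -subseq_rev.
Qed.

Lemma rinv_rev_nth s : rinv (rev s) = all (fun i => nth 0 s i <= i) (iota 0 (size s)).
Proof.
elim/last_ind: s => [|s x IH] //.
rewrite rev_rcons /= IH size_rcons -addn1 iotaD all_cat /= andbT add0n nth_rcons ltnn eqxx.
rewrite size_rev andbC; congr (_ && _); apply: eq_in_all => i.
by rewrite mem_iota add0n /= nth_rcons => ->.
Qed.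

Lemma I_count_rinvs n : I_count n = count good (rinvs n).
Proof.
rewrite /I_count cardE -size_filter.
have sz (f : {ffun 'I_n -> 'I_n}) : size (seq_of f) = n by rewrite size_map size_enum_ord.
have nthE (f : {ffun 'I_n -> 'I_n}) (i : 'I_n) : nth 0 (seq_of f) i = f i.
  by rewrite (nth_map i) ?size_enum_ord // nth_ord_enum.
rewrite -(size_map (fun f => rev (seq_of f))); apply/perm_size/uniq_perm.
- rewrite map_inj_uniq ?enum_uniq // => f g /(can_inj revK) E.
  by apply/ffunP => i; apply/val_inj; rewrite /= -!nthE E.
- exact/filter_uniq/rinvs_uniq.
move=> r; rewrite mem_filter mem_rinvs; apply/mapP/and3P => [[f Hf ->]|[H1 H2 H3]].
  move: Hf; rewrite mem_enum inE avoids_good => /andP[/forallP H1 ->].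
  rewrite size_rev sz eqxx; split=> //; rewrite rinv_rev_nth sz; apply/allP => i.
  rewrite mem_iota add0n => /= Hi; exact: leq_trans (eq_leq (nthE f (Ordinal Hi))) (H1 _).
have H : forall i : 'I_n, nth 0 (rev r) i <= i.
  move=> i; move: H3; rewrite -[r in rinv r]revK rinv_rev_nth => /allP; apply.
  by rewrite mem_iota size_rev (eqP H2) add0n /=.
(* The default of [insubd] is never taken: by [H] the i-th entry is at most i, hence below n. *)
pose f := [ffun i : 'I_n => insubd i (nth 0 (rev r) i)].
have fE i : f i = nth 0 (rev r) i :> nat.
  by rewrite ffunE val_insubd (leq_ltn_trans (H i)).
have Ef : seq_of f = rev r.
  apply: (@eq_from_nth _ 0) => [|i]; first by rewrite sz size_rev (eqP H2).
  by rewrite sz => Hi; rewrite (nthE f (Ordinal Hi)) fE.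
exists f; last by rewrite Ef revK.
rewrite mem_enum inE avoids_good Ef revK H1 andbT.
by apply/forallP => i; rewrite [val _]fE.
Qed.

(** * Appending one entry: weak increase and forced values *)

Lemma big_rinvsS n (F : seq nat -> nat) :
  \sum_(r <- rinvs n.+1) F r =
  \sum_(r <- rinvs n) \sum_(0 <= x < n.+1) F (x :: r).
Proof. by rewrite rinvsS big_allpairs_dep. Qed.

Lemma inc_cons x r : inc (x :: r) = (head 0 r <= x) && inc r.
Proof. by case: r. Qed.

Lemma inc_all_head r : inc r -> all (fun a => a <= head 0 r) r.
Proof.
case: r => //= x r; rewrite /inc leqnn /=.
by apply: order_path_min => a b c H1 H2; apply: leq_trans H2 H1.
Qed.

Lemma forces_inc x r : inc r -> forces x r.
Proof.
elim: r => // y r IH; rewrite inc_cons => /andP[H1 H2]; rewrite /= IH //=.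
apply/sub_all/(inc_all_head _ H2) => a Ha.
by apply/implyP => H; move: (leq_trans Ha H1); rewrite leqNgt H.
Qed.

Lemma good_inc r : inc r -> good r.
Proof. by elim: r => // y r IH; rewrite inc_cons => /andP[_ H]; rewrite /= IH ?forces_inc. Qed.

Lemma all_head_inc y r : inc r -> y < head 0 r ->
  forall x, all (fun a => (y < a) ==> (a == x)) r -> x = head 0 r.
Proof. by case: r => //= h r _ Hy x /andP[]; rewrite Hy => /eqP. Qed.

(** The last entry before the first descent exceeds its successor, so any appended entry must equal
    it. *)
Lemma forces_uniq r : ~~ inc r -> exists a, forall x, forces x r -> x = a.
Proof.
elim: r => // z r IH; rewrite inc_cons negb_and -ltnNge.
case: (boolP (inc r)) => [Hr|/IH[a Ha] _]; last by exists a => x /= /andP[/Ha].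
by rewrite orbF => Hz; exists (head 0 r) => x /= /andP[_]; apply: all_head_inc.
Qed.

(** The entry before the first descent is the maximum so far and equals y; all entries after that
    descent are forced to the same value. *)
Lemma forces_max y r : ~~ inc r -> good r -> forces y r ->
  all (fun a => a <= y) r.
Proof.
elim: r => // z r IH; rewrite inc_cons negb_and -ltnNge /=.
case: (boolP (inc r)) => [Hr|Hr _] /=.
  rewrite orbF => Hz _ /andP[_ /(all_head_inc _ _ Hr Hz) ->].
  by rewrite (ltnW Hz) inc_all_head.
case/andP=> Hg Hz /andP[Hy _]; have [a Ha] := forces_uniq _ Hr.
by rewrite (Ha _ Hz) -(Ha _ Hy) leqnn IH.
Qed.

(** * Recurrences for the counts *)

Definition num_inc n := \sum_(r <- rinvs n | inc r) 1.
(* [n - head 0 r] does not truncate on [rinvs n], by [head_rinvs]. *)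
Definition sum_inc n (g : nat -> nat) := \sum_(r <- rinvs n | inc r) g (n - head 0 r).
(* E_n of the header: one-entry extensions of the members of length n that are
   not weakly increasing. *)
Definition num_ext n :=
  \sum_(r <- rinvs n | ~~ inc r) \sum_(0 <= x < n.+1) (good r && forces x r : nat).
(* G_n of the header: weakly increasing sequences of length n followed by a
   descent after which the sequence can still be continued. *)
Definition num_drop n :=
  \sum_(r <- rinvs n | inc r) \sum_(0 <= y < n.+1)
    ((y < head 0 r) && all (fun a => (y < a) ==> (a == head 0 r)) r : nat).

Lemma eq_sum_inc n g g' : g =1 g' -> sum_inc n g = sum_inc n g'.
Proof. by move=> H; apply: eq_bigr => r _. Qed.

Lemma sum_nat_shift (g : nat -> nat) h n : h <= n ->
  \sum_(h <= x < n.+1) g x = \sum_(0 <= i < (n - h).+1) g (h + i).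
Proof.
by move=> H; rewrite -{1}[h]add0n big_addn subSn //; apply: eq_bigr => i _; rewrite addnC.
Qed.

Lemma sum_nat_shiftS (g : nat -> nat) h n :
  \sum_(h.+1 <= x < n.+1) g x = \sum_(0 <= i < n - h) g (i + h).+1.
Proof. by rewrite big_add1 -{1}[h]add0n big_addn. Qed.

Lemma sum_nat_ge (g : nat -> nat) h n : h <= n.+1 ->
  \sum_(0 <= x < n.+1) (if h <= x then g x else 0) = \sum_(h <= x < n.+1) g x.
Proof.
move=> H; rewrite (@big_cat_nat _ _ _ h) //= big_nat_cond big1 ?add0n.
  by rewrite big_nat_cond [RHS]big_nat_cond; apply: eq_bigr => i /andP[/andP[-> _] _].
by move=> i /andP[/andP[_ Hi] _]; rewrite leqNgt Hi.
Qed.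

(** Appending x to a sequence with gap d = n - [head 0 r] makes the gap n + 1 - x, which runs
    through 1, ..., d + 1. *)
Lemma sum_inc_rec n g :
  sum_inc n.+1 g = sum_inc n (fun d => \sum_(1 <= j < d.+2) g j).
Proof.
rewrite /sum_inc big_mkcond big_rinvsS [RHS]big_mkcond big_seq [RHS]big_seq.
apply: eq_bigr => r /head_rinvs Hr; case: (boolP (inc r)) => Hi; last first.
  by rewrite big1 // => x _; rewrite inc_cons (negbTE Hi) andbF.
under eq_bigr do rewrite inc_cons Hi andbT /=.
rewrite (sum_nat_ge (fun x => g (n.+1 - x))) ?leqW // sum_nat_shift //.
rewrite big_nat_rev [RHS]big_add1 /= big_nat_cond [RHS]big_nat_cond.
by apply: eq_bigr => i /andP[/andP[_ H] _]; congr g; lia.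
Qed.

Lemma num_incE n : num_inc n = sum_inc n (fun=> 1).
Proof. by []. Qed.

Lemma num_inc_S n : num_inc n.+1 = sum_inc n succn.
Proof.
rewrite num_incE sum_inc_rec; apply: eq_sum_inc => d.
by rewrite sum_nat_const_nat muln1 subn1.
Qed.

(** This identifies the binomial sum with T_n. Two entries can be appended to gap d in as many ways
    as the sum of j + 1 over 1 <= j <= d + 1. *)
Lemma num_inc_SS n : num_inc n.+2 = sum_inc n (fun d => 'C(d.+1, 2)) + (num_inc n.+1).*2.
Proof.
rewrite !num_inc_S sum_inc_rec -mul2n /sum_inc big_distrr -big_split /=.
apply: eq_bigr => r _; rewrite big_add1 /=.
elim: (n - _) => [|d IH]; first by rewrite big_nat1.
by rewrite big_nat_recr //= IH [in RHS]binS bin1; lia.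
Qed.

Lemma sum_nat_single (P : pred nat) x0 N : x0 < N -> (forall x, P x -> x = x0) ->
  \sum_(0 <= x < N) (P x : nat) = P x0.
Proof.
move=> H1 H2; rewrite (bigD1_seq x0) ?mem_index_iota ?iota_uniq //=.
rewrite big1 ?addn0 // => x /eqP Hx; case E: (P x) => //.
by case: Hx; apply: H2.
Qed.

Lemma num_drop0 : num_drop 0 = 0.
Proof. by rewrite /num_drop big_cons big_nil /= big_nat1. Qed.

(** All entries of [r] lie below h, so none of them may exceed y. *)
Lemma all_implies_gt h y r : inc r -> head 0 r < h ->
  (y < h) && (((y < h) ==> (h == h)) && all (fun a => (y < a) ==> (a == h)) r) =
  (head 0 r <= y < h).
Proof.
move=> Hi Hh; rewrite eqxx implybT /= andbC; congr (_ && _).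
apply/idP/idP => [|Hy]; last first.
  apply/sub_all/(inc_all_head _ Hi) => a Ha.
  by rewrite ltnNge (leq_trans Ha Hy).
case: r Hh {Hi} => //= x r Hh /andP[].
by rewrite (ltn_eqF Hh) implybF -leqNgt.
Qed.

Lemma sum_nat_interval a b n : a <= b <= n ->
  \sum_(0 <= y < n) (a <= y < b : nat) = b - a.
Proof.
case/andP=> Hab Hbn; rewrite (@big_cat_nat _ _ _ a) ?(leq_trans Hab) //=.
rewrite (@big_cat_nat _ _ _ b a n) //= !big_nat big1 => [|i /andP[_ Hi]]; last by rewrite leqNgt Hi.
rewrite [X in _ + (_ + X)]big1 => [|i /andP[Hi _]]; last by rewrite ltnNge Hi andbF.
under eq_bigr => i /andP[H1 H2] do rewrite H1 H2 /=.
by rewrite -big_nat sum_nat_const_nat muln1 addn0.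
Qed.

(** If the new last entry h equals [head 0 r], the admissible drops are those of [r]. If h =
    [head 0 r] + i + 1, there are i + 1 of them, and these add up to a binomial coefficient. *)
Lemma num_drop_rec n :
  num_drop n.+1 = num_drop n + sum_inc n (fun d => 'C(d.+1, 2)).
Proof.
rewrite /num_drop big_mkcond big_rinvsS -big_split /= [RHS]big_mkcond big_seq [RHS]big_seq.
apply: eq_bigr => r /head_rinvs Hr; case: (boolP (inc r)) => Hi; last first.
  by rewrite big1 // => x _; rewrite inc_cons (negbTE Hi) andbF.
under eq_bigr do rewrite inc_cons Hi andbT /=.
rewrite (sum_nat_ge (fun h => \sum_(0 <= y < n.+2)
  ((y < h) && (((y < h) ==> (h == h))
    && all (fun a => (y < a) ==> (a == h)) r) : nat))) ?leqW //.
rewrite big_ltn ?ltnS //; congr (_ + _).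
  rewrite big_nat_recr //= ltnNge leqW //= addn0; apply: eq_bigr => y _.
  by rewrite eqxx implybT.
rewrite sum_nat_shiftS -bin2_sum big_nat_recl // add0n.
rewrite [LHS]big_nat_cond [RHS]big_nat_cond; apply: eq_bigr => i /andP[/andP[_ Hin] _].
under eq_bigr => y _ do
  rewrite (all_implies_gt _ y _ Hi (leq_addl i (head 0 r) : head 0 r < _.+1)).
rewrite sum_nat_interval; lia.
Qed.

Lemma num_ext0 : num_ext 0 = 0.
Proof. by rewrite /num_ext big_cons big_nil. Qed.

(** If y makes the first descent, only [head 0 r] can follow, which gives [num_drop]. After an
    earlier descent y is the forced value and only y can follow, which gives [num_ext] again. *)
Lemma num_ext_rec n : num_ext n.+1 = num_ext n + num_drop n.
Proof.
rewrite /num_ext /num_drop [LHS]big_mkcond big_rinvsS.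
rewrite [X in _ = X + _]big_mkcond [X in _ = _ + X]big_mkcond -big_split /=.
rewrite big_seq [RHS]big_seq.
apply: eq_bigr => r Hr; have {Hr} Hh := head_rinvs _ _ Hr.
case: (boolP (inc r)) => Hi /=.
  rewrite add0n; apply: eq_bigr => y _; rewrite inc_cons Hi andbT -ltnNge good_inc //= forces_inc //=.
  case: ltnP => // Hy /=; rewrite (sum_nat_single _ (head 0 r)) ?forces_inc // ?ltnS ?leqW //.
  by move=> x /andP[_]; apply: all_head_inc.
rewrite addn0 big_nat_cond [RHS]big_nat_cond; apply: eq_bigr => y /andP[/andP[_ Hy] _].
rewrite inc_cons (negbTE Hi) andbF /=; case: (boolP (good r)) => Hg /=; last first.
  by rewrite big1.
case: (boolP (forces y r)) => Hf /=; last by rewrite big1.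
have [a Ha] := forces_uniq _ Hi.
rewrite (sum_nat_single _ y) ?Hf /=; last 2 first.
- exact: leqW.
- by move=> x /andP[/Ha -> _]; rewrite (Ha _ Hf).
(* No entry exceeds the forced value y, so repeating y is always allowed. *)
rewrite (_ : all _ _ = true) //; apply/sub_all/(forces_max _ _ Hi Hg Hf) => b.
by move=> Hb; apply/implyP; rewrite ltnNge Hb.
Qed.

Lemma I_count0 : I_count 0 = 1.
Proof. by rewrite I_count_rinvs. Qed.

Lemma I_count_rec n : I_count n.+1 = n.+1 * num_inc n + num_ext n.
Proof.
rewrite I_count_rinvs -sum1_count big_mkcond big_rinvsS /num_inc /num_ext.
rewrite big_distrr /=.
rewrite [X in _ = X + _]big_mkcond [X in _ = _ + X]big_mkcond -big_split /=.
apply: eq_bigr => r _; case: (boolP (inc r)) => Hi /=.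
  under eq_bigr do rewrite good_inc // forces_inc //.
  by rewrite sum_nat_const_nat subn0 addn0.
by rewrite add0n; apply: eq_bigr => x _; case: (_ && _).
Qed.

(** * Ballot and Catalan numbers *)

(* [ballot n d] counts the weakly increasing continuations by n entries of a
   sequence of length l whose last entry is l - d. *)
Fixpoint ballot n d :=
  if n is m.+1 then \sum_(1 <= j < d.+2) ballot m j else 1.

Lemma num_inc_ballot n : num_inc n = ballot n 0.
Proof.
(* Generalised to n entries already placed and k still to come. *)
have H k : sum_inc n (ballot k) = ballot (n + k) 0.
  elim: n k => [|n IH] k; first by rewrite /sum_inc big_cons big_nil /= addn0.
  by rewrite sum_inc_rec addSnnS -IH.
by rewrite num_incE -[n in RHS]addn0 -H.
Qed.

Lemma ballot_SS n d : ballot n.+1 d.+1 = ballot n.+1 d + ballot n d.+2.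
Proof. by rewrite /= big_nat_recr. Qed.

(** The ballot number (d+1) (2n+d)! / (n! (n+d+1)!), cross-multiplied to stay in [nat]; d = 0 gives
    Catalan numbers. Induction on n, then on d along [ballot_SS]. *)
Lemma ballotE n d :
  ballot n d * (n`! * (n + d).+1`!) = d.+1 * (n.*2 + d)`!.
Proof.
elim: n d => [|n IHn] d; first by rewrite !mul1n add0n factS.
elim: d => [|d IHd].
  have := IHn 1; rewrite [ballot n.+1 0]/= big_nat1 doubleS !addnS !addn0.
  rewrite [(n.*2).+2`!]factS [n.+1`!]factS; nia.
rewrite ballot_SS; move: IHd (IHn d.+2).
rewrite !doubleS !addSn !addnS.
rewrite [(n + d).+3`!]factS [(n.*2 + d).+3`!]factS [n.+1`!]factS.
move: (ballot n.+1 d) (ballot n d.+2) => x y.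
move: (n`!) ((n + d).+2`!) ((n.*2 + d).+2`!) => a p q Hx Hy.
transitivity ((n + d).+3 * (x * (n.+1 * a * p)) + n.+1 * (y * (a * ((n + d).+3 * p)))); first by ring.
by rewrite Hx Hy -muln2; ring.
Qed.
End Counting.

(** * Power series laws by polynomial truncation *)

Definition agree (n : nat) (f : fps) (p : {poly rat}) :=
  forall k, (k <= n)%N -> f k = p`_k.

Lemma agree_mul {n f g p q} :
  agree n f p -> agree n g q -> agree n (fps_mul f g) (p * q).
Proof.
move=> Hp Hq k Hk; rewrite coefM; apply: eq_bigr => i _.
by rewrite Hp ?Hq //; have := ltn_ord i; lia.
Qed.

Lemma agree_trunc n (f : fps) : agree n f (\poly_(i < n.+1) f i).
Proof. by move=> k Hk; rewrite coef_poly ltnS Hk. Qed.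

Lemma fps_mulC f g : fps_mul f g =1 fps_mul g f.
Proof.
move=> n; have [Hf Hg] := (agree_trunc n f, agree_trunc n g).
by rewrite (agree_mul Hf Hg) // (agree_mul Hg Hf) // mulrC.
Qed.

Lemma fps_mulA f g h : fps_mul f (fps_mul g h) =1 fps_mul (fps_mul f g) h.
Proof.
move=> n; have [Hf Hg Hh] := And3 (agree_trunc n f) (agree_trunc n g) (agree_trunc n h).
rewrite (agree_mul Hf (agree_mul Hg Hh)) //.
by rewrite (agree_mul (agree_mul Hf Hg) Hh) // mulrA.
Qed.

Lemma eq_fps_mul {f f' g g'} : f =1 f' -> g =1 g' -> fps_mul f g =1 fps_mul f' g'.
Proof. by move=> Hf Hg n; apply: eq_bigr => i _; rewrite Hf Hg. Qed.

Lemma fps_mul_poly0 f n : fps_mul (fps_poly [::]) f n = 0.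
Proof. by rewrite /fps_mul big1 // => i _; rewrite /fps_poly nth_nil mul0r. Qed.

Lemma fps_mul_poly_cons a l f n :
  fps_mul (fps_poly (a :: l)) f n =
  a * f n + (if n is m.+1 then fps_mul (fps_poly l) f m else 0).
Proof.
case: n => [|n]; rewrite /fps_mul big_ord_recl ?big_ord0 /= ?subn0 //.
Qed.

(** * Derivatives and the coefficients of the square root *)

Definition fps_deriv (f : fps) : fps := fun n => n.+1%:R * f n.+1.

Lemma fps_deriv_mul f g n :
  fps_deriv (fps_mul f g) n =
  fps_mul (fps_deriv f) g n + fps_mul f (fps_deriv g) n.
Proof.
(* Coefficient n of a derivative reads coefficient n + 1, so the truncation keeps one more
   degree. *)
have [Hf Hg] := (agree_trunc n.+1 f, agree_trunc n.+1 g).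
move: (\poly_(i < _) _) (\poly_(i < _) _) Hf Hg => p q Hp Hq.
have D h r : agree n.+1 h r -> agree n (fps_deriv h) r^`().
  by move=> H k Hk; rewrite coef_deriv /fps_deriv H // mulr_natl.
have W h r : agree n.+1 h r -> agree n h r by move=> H k Hk; apply: H; lia.
rewrite (D _ _ (agree_mul Hp Hq)) // (agree_mul (D _ _ Hp) (W _ _ Hq)) //.
by rewrite (agree_mul (W _ _ Hp) (D _ _ Hq)) // derivM coefD.
Qed.

(** Differentiating S^2 = 1 - 4z gives S S' = -2. Multiplying by S yields (1 - 4z) S' = -2 S without
    dividing by S. *)
Lemma sqrt_rec (S : fps) :
  (forall n, fps_mul S S n = fps_poly [:: 1; -4] n) ->
  forall n, n.+1%:R * S n.+1 = (4 * n%:R - 2) * S n.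
Proof.
move=> HS n.
have H k : fps_mul S (fps_deriv S) k = fps_poly [:: -2] k.
  have: fps_deriv (fps_mul S S) k = fps_poly [:: -4] k.
    by rewrite /fps_deriv HS; case: k => [|k]; rewrite /fps_poly /= ?nth_nil ?mulr0 ?mul1r.
  rewrite fps_deriv_mul (fps_mulC (fps_deriv S)).
  by case: k => [|k]; rewrite /fps_poly /= ?nth_nil; lra.
have: fps_mul (fps_poly [:: -2]) S n = fps_mul (fps_poly [:: 1; -4]) (fps_deriv S) n.
  rewrite -(eq_fps_mul HS (frefl _)) -fps_mulA fps_mulC.
  by apply: eq_fps_mul => // k; rewrite H.
rewrite !fps_mul_poly_cons /fps_deriv; case: n => [|n]; rewrite ?fps_mul_poly_cons ?fps_mul_poly0.
  by lra.
case: n => [|n]; rewrite ?fps_mul_poly0; lra.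
Qed.

Lemma num_inc_rec n : (n.+2 * num_inc n.+1 = (4 * n + 2) * num_inc n)%N.
Proof.
have := ballotE n.+1 0; have := ballotE n 0; rewrite -!num_inc_ballot !addn0 !mul1n.
rewrite doubleS [(n.*2).+2`!]factS [(n.*2).+1`!]factS [n.+2`!]factS.
have := fact_gt0 n; have := fact_gt0 n.+1; rewrite factS.
move: (num_inc n) (num_inc n.+1) (n`!) (n.*2`!) => x y a q Ha1 Ha Hx Hy.
have Hp : (0 < a * (n.+1 * a))%N by rewrite muln_gt0 Ha.
apply/eqP; rewrite -(eqn_pmul2r Hp); apply/eqP.
(* The total factor is (n+1)! squared, as [a] stands for n!. *)
have H : (n.+1 * (n.+2 * y * (a * (n.+1 * a))) = n.+1 * ((4 * n + 2) * x * (a * (n.+1 * a))))%N.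
  transitivity (y * (n.+1 * a * (n.+2 * (n.+1 * a))))%N; first by ring.
  by rewrite Hy -Hx -muln2; ring.
by move/eqP: H; rewrite eqn_pmul2l // => /eqP.
Qed.

(** [sqrt_rec] at n + 1 has the factor 4(n+1) - 2 = 4n + 2, the same as in [num_inc_rec]. *)
Lemma sqrt_num_inc (S : fps) : S 0%N = 1 ->
  (forall n, fps_mul S S n = fps_poly [:: 1; -4] n) ->
  forall n, S n.+1 = - 2 * (num_inc n)%:R.
Proof.
move=> S0 HS; have R := sqrt_rec S HS; elim=> [|n IH].
  by have := R 0%N; rewrite S0 num_inc_ballot /=; lra.
have nz : n.+2%:R != 0 :> rat by rewrite pnatr_eq0.
apply: (mulfI nz); rewrite R IH; have /(congr1 (fun k => k%:R : rat)) := num_inc_rec n.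
rewrite natrM [in RHS]natrM natrD natrM => H.
transitivity (- 2 * ((4 * n%:R + 2) * (num_inc n)%:R) : rat); first by rewrite -natr1; ring.
by rewrite -H; ring.
Qed.

(** * The generating function *)

Lemma fps_mul_den I n :
  fps_mul (fps_mul (fps_mul (fps_poly [:: 2])
     (fps_mul (fps_poly [:: 1; -1]) (fps_poly [:: 1; -1]))) (fps_poly [:: 1; -4])) I n =
  fps_mul (fps_poly [:: 2]) (fps_mul (fps_poly [:: 1; -1])
    (fps_mul (fps_poly [:: 1; -1]) (fps_mul (fps_poly [:: 1; -4]) I))) n.
Proof.
rewrite -fps_mulA -fps_mulA; apply: eq_fps_mul => // k.
by rewrite -fps_mulA.
Qed.

Lemma I_count_den (S : fps) : S 0%N = 1 ->
  (forall n, fps_mul S S n = fps_poly [:: 1; -4] n) ->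
  fps_mul (fps_mul (fps_mul (fps_poly [:: 2])
     (fps_mul (fps_poly [:: 1; -1]) (fps_poly [:: 1; -1]))) (fps_poly [:: 1; -4]))
     (fun n => (I_count n)%:R) =1
  fps_sub
         (fps_mul (fps_mul (fps_poly [:: 1; -4]) (fps_poly [:: 1; -2])) (fps_poly [:: 3; -2]))
         (fps_mul (fps_poly [:: 1; -8; 12; -2]) S).
Proof.
move=> S0 HS n; have HSn := sqrt_num_inc S S0 HS.
have HI k : (I_count k.+1)%:R = (k.+1%:R * (num_inc k)%:R + (num_ext k)%:R : rat).
  by rewrite I_count_rec natrD natrM.
have HE k : (num_ext k.+1)%:R = ((num_ext k)%:R + (num_drop k)%:R : rat).
  by rewrite num_ext_rec natrD.
have HG k : (num_drop k.+1)%:R = ((num_drop k)%:R + ((num_inc k.+2)%:R - 2 * (num_inc k.+1)%:R) : rat).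
  by rewrite num_drop_rec num_inc_SS -muln2 !natrD natrM; ring.
have c0 : num_inc 0 = 1%N by rewrite num_inc_ballot.
have HC k : (num_inc k.+1)%:R = ((4 * k%:R + 2) / (k%:R + 2) * (num_inc k)%:R : rat).
  have nz : k%:R + 2 != 0 :> rat by rewrite -natrD pnatr_eq0 addn2.
  have /(congr1 (fun m => m%:R : rat)) := num_inc_rec k.
  rewrite -[k.+2]addn2 2!natrM [in RHS]natrD [in RHS]natrM [(k + 2)%:R]natrD => H.
  by apply: (mulfI nz); rewrite H; field.
rewrite fps_mul_den /fps_sub -fps_mulA.
(* All polynomials have degree 3, so from index 4 on neither [S 0] nor [I_count 0] enters and the
   recurrences apply uniformly. *)
case: n => [|[|[|[|n]]]]; rewrite !fps_mul_poly_cons ?fps_mul_poly0 /fps_poly /=.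
1-4: by rewrite ?HI ?HSn ?HE ?HG ?HC ?num_ext0 ?num_drop0 ?c0 ?S0 ?I_count0; field.
rewrite nth_nil !HI !HSn !HE !HG !HC -!natr1.
have: 0 <= n%:R :> rat by rewrite ler0n.
(* Both sides are now linear in e, g, c with coefficients rational in t, so these may be treated as
   independent variables; [Ht] keeps denominators nonzero. *)
move: (n%:R) (num_ext n)%:R (num_drop n)%:R (num_inc n)%:R => t e g c Ht.
field; repeat (apply/andP; split); apply: lt0r_neq0; lra.
Qed.

(* For S the power series sqrt(1-4z) (constant term 1, S^2 = 1-4z) and Dinv
   the inverse of the denominator 2(1-z)^2(1-4z), the generating function
   sum I_n z^n equals ((1-4z)(1-2z)(3-2z) - (1-8z+12z^2-2z^3) S) * Dinv. *)
Theorem mainTheorem5 (S Dinv : fps) :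
  S 0%N = 1 ->
  (forall n, fps_mul S S n = fps_poly [:: 1; -4] n) ->
  (forall n, fps_mul (fps_mul (fps_mul (fps_poly [:: 2])
                                       (fps_mul (fps_poly [:: 1; -1]) (fps_poly [:: 1; -1])))
                              (fps_poly [:: 1; -4])) Dinv n = fps_one n) ->
  forall n : nat,
    (I_count n)%:R =
    fps_mul
      (fps_sub
         (fps_mul (fps_mul (fps_poly [:: 1; -4]) (fps_poly [:: 1; -2])) (fps_poly [:: 3; -2]))
         (fps_mul (fps_poly [:: 1; -8; 12; -2]) S))
      Dinv n.
Proof.
move=> S0 HS HD n; have HI := I_count_den S S0 HS.
(* The numerator is replaced by denominator times series, and the denominator then cancels against
   [Dinv]. *)
rewrite -(eq_fps_mul HI (frefl Dinv)) (eq_fps_mul (fps_mulC _ _) (frefl Dinv)).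
rewrite -fps_mulA (eq_fps_mul (frefl _) HD) fps_mulC fps_mul_poly_cons mul1r.
by case: n => [|n]; rewrite ?fps_mul_poly0 addr0.
Qed.
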